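(* For any non-degenerate triangle with side lengths $a,b,c$ and respective altitudes $h_a,h_b,h_c$, both of the following inequalities hold: \[ \sqrt{bc}\, h_a+ \sqrt{ac}\, h_b+\sqrt{ab}\, h_c \;\geq\; a\, h_a+ b\, h_b+c\, h_c \] and \[ (bc-a^2)\, h_a+ (ac-b^2)\, h_b+(ab-c^2)\, h_c \;\geq\; 0 . \]
   Context: $h_a,h_b,h_c$ denote the lengths of the altitudes to the sides of lengths $a,b,c$ respectively, so $a h_a=b h_b=c h_c=2S$, where $S>0$ is the area of the triangle. Positive reals $a,b,c$ are the sides of a non-degenerate triangle iff $a+b>c$, $b+c>a$, $a+c>b$. *)

(* Defs.v *)
From Stdlib Require Import Reals.
Open Scope R_scope.

(** Points of the Euclidean plane, in Cartesian coordinates. *)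
Definition point : Type := (R * R)%type.

Definition distance (P Q : point) : R := dist_euc (fst P) (snd P) (fst Q) (snd Q).

(** Area of the triangle [A B C] by the shoelace formula. *)
Definition area (A B C : point) : R :=
  Rabs ((fst B - fst A) * (snd C - snd A)
        - (snd B - snd A) * (fst C - fst A)) / 2.

Definition nondegenerate (A B C : point) : Prop := 0 < area A B C.

(** [X] lies on the (infinite) line through [P] and [Q], for [P <> Q]. *)
Definition on_line (P Q X : point) : Prop :=
  exists t : R,
    fst X = fst P + t * (fst Q - fst P) /\
    snd X = snd P + t * (snd Q - snd P).

(** The vectors [PQ] and [RS] are orthogonal. *)
Definition orthogonal (P Q R S : point) : Prop :=
  (fst Q - fst P) * (fst S - fst R) + (snd Q - snd P) * (snd S - snd R) = 0.

(** [h] is the length of the altitude from [A] to the side [B C]. Its foot [F]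
    is on the line [B C] but, in an obtuse triangle, possibly outside the
    segment. *)
Definition altitude_length (A B C : point) (h : R) : Prop :=
  exists F : point, on_line B C F /\ orthogonal A F B C /\ h = distance A F.

(* Main.v *)
Require Import Defs.
From Stdlib Require Import Reals Lra.
Open Scope R_scope.

(** Since [a h_a = b h_b = c h_c = 2S], dividing by [2S] turns the first claim
    into [sqrt (bc) / a + sqrt (ca) / b + sqrt (ab) / c >= 3], which is AM-GM for
    three numbers of product 1, and the second into
    [bc/a + ca/b + ab/c >= a + b + c], which is [X^2 + Y^2 + Z^2 >= XY + YZ + ZX]
    for [X = bc], [Y = ca], [Z = ab]. *)

Lemma area_rotate (A B C : point) : area B C A = area A B C.
Proof. unfold area; do 2 f_equal; ring. Qed.

Lemma base_times_altitude (A B C : point) (h : R) :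
  altitude_length A B C h -> distance B C * h = 2 * area A B C.
Proof.
  intros [F [[t [HFx HFy]] [Horth ->]]].
  unfold orthogonal in Horth; unfold distance, area, dist_euc, Rsqr in *.
  destruct A as [ax ay], B as [bx by'], C as [cx cy], F as [fx fy];
    simpl in *; subst fx fy.
  match goal with |- _ = 2 * (Rabs ?d / 2) =>
    replace (2 * (Rabs d / 2)) with (Rabs d) by field end.
  (* Both sides become single square roots, with [Rabs d] read as the root of [d] squared, so only
     the radicands remain to be compared. *)
  rewrite <- sqrt_mult by (apply Rplus_le_le_0_compat; apply Rle_0_sqr).
  rewrite <- sqrt_Rsqr_abs; f_equal; unfold Rsqr.
  (* Lagrange's identity |AF|^2 |BC|^2 = (AF x BC)^2 + (AF . BC)^2, together
     with AF x BC = AB x AC because F is on BC. *)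
  match type of Horth with ?l = 0 =>
    match goal with |- _ = ?r => transitivity (r + l * l); [ring | rewrite Horth; ring]
    end end.
Qed.

(** A base of length 0 would make base times altitude, hence the area, vanish. *)
Lemma distance_pos_of_altitude (A B C : point) (h : R) :
  nondegenerate A B C -> altitude_length A B C h -> 0 < distance B C.
Proof.
  intros Hnd Hh; pose proof (base_times_altitude _ _ _ _ Hh) as E.
  unfold nondegenerate in Hnd.
  assert (H0 : 0 <= distance B C) by apply sqrt_pos.
  destruct H0 as [H0 | H0]; [exact H0 | rewrite <- H0 in E; lra].
Qed.

Lemma amgm3 (x y z : R) :
  0 <= x -> 0 <= y -> 0 <= z -> 3 * (x * y * z) <= x ^ 3 + y ^ 3 + z ^ 3.
Proof.
  intros Hx Hy Hz.
  (* This product is twice [x ^ 3 + y ^ 3 + z ^ 3 - 3 * (x * y * z)]. *)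
  assert (0 <= (x + y + z) * ((x - y) ^ 2 + (y - z) ^ 2 + (z - x) ^ 2)).
  { apply Rmult_le_pos; [lra |].
    repeat apply Rplus_le_le_0_compat; apply pow2_ge_0. }
  lra.
Qed.

Lemma sum_sqrt_mul_div_ge_3 (a b c : R) : 0 < a -> 0 < b -> 0 < c ->
  3 <= sqrt (b * c) / a + sqrt (a * c) / b + sqrt (a * b) / c.
Proof.
  intros Ha Hb Hc.
  rewrite !sqrt_mult by lra.
  pose proof (sqrt_lt_R0 a Ha) as Hp; pose proof (sqrt_lt_R0 b Hb) as Hq;
    pose proof (sqrt_lt_R0 c Hc) as Hr.
  pose proof (sqrt_sqrt a (Rlt_le _ _ Ha)) as Ea;
    pose proof (sqrt_sqrt b (Rlt_le _ _ Hb)) as Eb;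
    pose proof (sqrt_sqrt c (Rlt_le _ _ Hc)) as Ec.
  set (p := sqrt a) in *; set (q := sqrt b) in *; set (r := sqrt c) in *.
  clearbody p q r; subst a b c.
  (* With [a = p * p], [b = q * q], [c = r * r], this factor clears the denominators and turns the
     three terms into the cubes of [q * r], [p * r], [p * q]. *)
  apply Rmult_le_reg_r with ((p * q * r) ^ 2).
  { apply pow_lt; repeat apply Rmult_lt_0_compat; assumption. }
  replace ((q * r / (p * p) + p * r / (q * q) + p * q / (r * r)) * (p * q * r) ^ 2)
    with ((q * r) ^ 3 + (p * r) ^ 3 + (p * q) ^ 3) by (field; lra).
  replace (3 * (p * q * r) ^ 2) with (3 * (q * r * (p * r) * (p * q))) by ring.
  apply amgm3; apply Rmult_le_pos; lra.
Qed.

Lemma sum_mul_div_ge_sum (a b c : R) : 0 < a -> 0 < b -> 0 < c ->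
  a + b + c <= b * c / a + a * c / b + a * b / c.
Proof.
  intros Ha Hb Hc.
  apply Rmult_le_reg_r with (a * b * c).
  { repeat apply Rmult_lt_0_compat; assumption. }
  replace ((b * c / a + a * c / b + a * b / c) * (a * b * c))
    with ((b * c) ^ 2 + (a * c) ^ 2 + (a * b) ^ 2) by (field; lra).
  (* Half the sum of these three squares is the difference of the two sides. *)
  pose proof (pow2_ge_0 (b * c - a * c)); pose proof (pow2_ge_0 (a * c - a * b));
    pose proof (pow2_ge_0 (a * b - b * c)).
  lra.
Qed.

Theorem mainTheorem2 (A B C : point) (a b c h_a h_b h_c : R)
  (hABC : nondegenerate A B C)
  (ha : a = distance B C) (hb : b = distance C A) (hc : c = distance A B)
  (hha : altitude_length A B C h_a)
  (hhb : altitude_length B C A h_b)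
  (hhc : altitude_length C A B h_c) :
  sqrt (b * c) * h_a + sqrt (a * c) * h_b + sqrt (a * b) * h_c
    >= a * h_a + b * h_b + c * h_c
  /\
  (b * c - a ^ 2) * h_a + (a * c - b ^ 2) * h_b + (a * b - c ^ 2) * h_c >= 0.
Proof.
  assert (hBCA : nondegenerate B C A)
    by (unfold nondegenerate; rewrite area_rotate; exact hABC).
  assert (hCAB : nondegenerate C A B)
    by (unfold nondegenerate; rewrite area_rotate; exact hBCA).
  pose proof (distance_pos_of_altitude _ _ _ _ hABC hha) as Pa.
  pose proof (distance_pos_of_altitude _ _ _ _ hBCA hhb) as Pb.
  pose proof (distance_pos_of_altitude _ _ _ _ hCAB hhc) as Pc.
  pose proof (base_times_altitude _ _ _ _ hha) as Ea.
  pose proof (base_times_altitude _ _ _ _ hhb) as Eb.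
  pose proof (base_times_altitude _ _ _ _ hhc) as Ec.
  (* Cyclic rotation expresses all three products through the one area [area A B C]. *)
  rewrite (area_rotate B C A) in Ec; rewrite (area_rotate A B C) in Eb, Ec.
  unfold nondegenerate in hABC.
  rewrite <- ha in *; rewrite <- hb in *; rewrite <- hc in *.
  set (T := 2 * area A B C) in *.
  assert (PT : 0 <= T) by (unfold T; lra).
  assert (Ha : h_a = T / a) by (rewrite <- Ea; field; lra).
  assert (Hb : h_b = T / b) by (rewrite <- Eb; field; lra).
  assert (Hc : h_c = T / c) by (rewrite <- Ec; field; lra).
  rewrite Ha, Hb, Hc.
  split; apply Rle_ge.
  - replace (a * (T / a) + b * (T / b) + c * (T / c)) with (T * 3) by (field; lra).
    replace (sqrt (b * c) * (T / a) + sqrt (a * c) * (T / b) + sqrt (a * b) * (T / c))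
      with (T * (sqrt (b * c) / a + sqrt (a * c) / b + sqrt (a * b) / c))
      by (field; lra).
    apply Rmult_le_compat_l; [exact PT | apply sum_sqrt_mul_div_ge_3; assumption].
  (* Each term splits as in [(b * c - a ^ 2) * (T / a) = T * (b * c / a - a)]. *)
  - replace ((b * c - a ^ 2) * (T / a) + (a * c - b ^ 2) * (T / b)
             + (a * b - c ^ 2) * (T / c))
      with (T * (b * c / a + a * c / b + a * b / c - (a + b + c))) by (field; lra).
    apply Rmult_le_pos; [exact PT |].
    pose proof (sum_mul_div_ge_sum a b c Pa Pb Pc); lra.
Qed.
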